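(* $$\limsup_{k\to\infty}\frac{|U(1,2)\cap[1,k]|}{k}\le\frac{6}{17}.$$
   Context: $U(1,2)$ is the classical Ulam sequence $1,2,3,4,6,8,11,\dots$: the increasing sequence with first terms $1,2$, each subsequent term being the smallest integer larger than the previous term that is a sum $u+v$ of two earlier terms $u<v$ in exactly one way; it is identified with its set of terms. *)

(* Defs.v *)
From mathcomp Require Import all_boot all_order all_algebra zify.
From mathcomp Require Import finmap all_classical all_reals all_analysis.

Set Implicit Arguments.
Unset Strict Implicit.
Unset Printing Implicit Defensive.

Local Open Scope classical_set_scope.

(* Initial segments of the sequence are listed latest term first, so that
   [head 0 s] is the previous term. *)
Definition ulam_reps (s : seq nat) (n : nat) : nat :=
  count (fun p : nat * nat => (p.1 < p.2) && (p.1 + p.2 == n))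
        [seq (u, v) | u <- s, v <- s].

Definition ulam_candidate (s : seq nat) : pred nat :=
  fun n => (head 0 s < n) && (ulam_reps s n == 1).

Definition ulam_prefix : Type :=
  {s : seq nat | [&& 1 < size s, sorted gtn s & 0 \notin s]}.

(* The sum of the two latest terms is always a candidate. *)
Lemma ulam_candidate_ex (s : ulam_prefix) : exists n, ulam_candidate (sval s) n.
Proof.
case: s => -[|a [|b s]] // hs; have /and3P[_ sab n0] := hs; rewrite [sval _]/=.
have gtn_trans : transitive gtn by move=> y x z /=; lia.
have us : uniq [:: a, b & s].
  by apply: (sorted_uniq gtn_trans) => // x /=; rewrite ltnn.
have bs x : x \in s -> x < b.
  move: sab => /= /andP[_]; rewrite (path_sortedE gtn_trans) => /andP[/allP h _].
  exact: h.
have ab : b < a by move: sab => /= /andP[].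
have b0 : 0 < b by move: n0; rewrite !inE; lia.
exists (a + b); apply/andP; split; first by rewrite /=; lia.
rewrite /ulam_reps (@eq_in_count _ _ (pred1 (b, a))).
  rewrite count_uniq_mem; first by rewrite allpairs_f // !inE eqxx ?orbT.
  by apply: allpairs_uniq => // -[x y] [z t].
case=> x y /allpairsP[[u v] /= [hu hv [-> ->]]].
rewrite xpair_eqE.
move: hu hv; rewrite !inE => /or3P[/eqP->|/eqP->|/bs hu] /or3P[/eqP->|/eqP->|/bs hv]; lia.
Qed.

Definition ulam_next (s : ulam_prefix) : nat := ex_minn (ulam_candidate_ex s).

Lemma ulam_extend_subproof (s : ulam_prefix) :
  [&& 1 < size (ulam_next s :: sval s), sorted gtn (ulam_next s :: sval s)
    & 0 \notin ulam_next s :: sval s].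
Proof.
rewrite /ulam_next; case: ex_minnP => m /andP[hm _] _.
case: s hm => -[|a s] // hs; have /and3P[s1 sas n0] := hs.
rewrite [sval _]/= [head _ _]/= => am; apply/and3P; split.
- exact: leq_trans s1 _.
- by rewrite /= am.
- by rewrite in_cons negb_or n0 andbT; lia.
Qed.

Definition ulam_extend (s : ulam_prefix) : ulam_prefix :=
  exist _ (ulam_next s :: sval s) (ulam_extend_subproof s).

Definition ulam12_start : ulam_prefix := exist _ [:: 2; 1] isT.

Definition ulam12 (n : nat) : nat :=
  if n is m.+1 then head 0 (sval (iter m ulam_extend ulam12_start)) else 1.

Definition U12 : set nat := range ulam12.

(* The set is finite, so the default [fset0] of [fset_set] never occurs. *)
Definition U12_count (k : nat) : nat :=
  #|` fset_set (U12 `&` [set n | (1 <= n <= k)%N]) |%fset.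

(* Main.v *)
Require Import Defs.
From mathcomp Require Import all_boot all_order all_algebra.
From mathcomp Require Import all_classical all_reals all_analysis.
From mathcomp Require Import zify lra.

(** If [n] is an Ulam number, then [n - u] is an Ulam number for at most one
    Ulam number [u < n / 2], since each such [u] gives a representation of [n].
    Taking [u] in {1, 2, 3, 4, 6, 8, 11}, this is a local constraint on the
    Ulam numbers larger than 22, and a finite check shows that it allows at most
    4 of them among any 12 consecutive integers.  Hence the upper density is at
    most 1/3, which is smaller than 6/17. *)

Import Order.TTheory GRing.Theory Num.Theory.

Local Open Scope ring_scope.

Lemma ulam_nextP (s : ulam_prefix) :
  ulam_candidate (sval s) (ulam_next s) /\
  forall n, ulam_candidate (sval s) n -> (ulam_next s <= n)%N.
Proof. by rewrite /ulam_next; case: ex_minnP. Qed.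

(** [ulam_next] does not evaluate, since its existence proof is opaque; this boolean criterion
    certifies concrete terms instead. *)
Lemma ulam_next_eq (s : ulam_prefix) (n : nat) :
  ulam_candidate (sval s) n ->
  ~~ has (ulam_candidate (sval s)) (iota 0 n) -> ulam_next s = n.
Proof.
move=> cn /hasPn hn; have [cs /(_ _ cn) sn] := ulam_nextP s.
apply/eqP; rewrite eqn_leq sn leqNgt; apply/negP => lt_sn.
by move: cs; apply/negP/hn; rewrite mem_iota.
Qed.

(** The [m + 2] terms from [ulam12 m.+1] down to [ulam12 0]. *)
Definition ulam_initial (m : nat) : seq nat :=
  sval (iter m ulam_extend ulam12_start).

Lemma ulam_initialS (m : nat) :
  ulam_initial m.+1 =
  ulam_next (iter m ulam_extend ulam12_start) :: ulam_initial m.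
Proof. by []. Qed.

Lemma ulam12_candidate (m : nat) :
  ulam_candidate (ulam_initial m) (ulam12 m.+2).
Proof. by have [] := ulam_nextP (iter m ulam_extend ulam12_start). Qed.

Lemma ulam12_ltn : {homo ulam12 : i j / (i < j)%N}.
Proof.
apply: homo_ltn => [y x z|[|i]]; [exact: ltn_trans | by [] |].
by have /andP[] := ulam12_candidate i.
Qed.

Lemma U12_gt0 (n : nat) : n \in U12 -> (0 < n)%N.
Proof.
by move=> /set_mem[[|j] _ <-] //; apply: leq_trans (ulam12_ltn 0 j.+1 _).
Qed.

Lemma ulam12_in_initial (m j : nat) :
  (j <= m.+1)%N -> ulam12 j \in ulam_initial m.
Proof.
elim: m => [|m IHm]; first by case: j => [|[|]].
rewrite ulam_initialS in_cons leq_eqVlt => /orP[/eqP->|/IHm->].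
  by rewrite eqxx.
by rewrite orbT.
Qed.

Lemma ulam_initial_sub_U12 (m u : nat) : u \in ulam_initial m -> u \in U12.
Proof.
elim: m => [|m IHm].
  rewrite !inE => /orP[]/eqP->; [by exists 1%N | by exists 0%N].
rewrite ulam_initialS in_cons => /orP[/eqP->|/IHm //].
by apply/mem_set; exists m.+2.
Qed.

Lemma U12_reps (n : nat) (s : seq nat) :
  (2 < n)%N -> n \in U12 -> uniq s -> {in s, forall u, u \in U12} ->
  {in s, forall u, (u < n - u)%N} ->
  (count (fun u => (n - u)%N \in U12) s <= 1)%N.
Proof.
move=> n2 /set_mem[[|[|m]] _ nE] us sU sn; try by rewrite -nE in n2.
have /andP[_ /eqP reps1] := ulam12_candidate m; rewrite nE in reps1.
(* By monotonicity, every Ulam number below [n] was available when [n] was chosen. *)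
have initP u : u \in U12 -> (u < n)%N -> u \in ulam_initial m.
  move=> /set_mem[j _ <-]; rewrite -nE => ltj; apply: ulam12_in_initial.
  rewrite -ltnS ltnNge; apply/negP; rewrite leq_eqVlt => /orP[/eqP jE|].
    by rewrite -jE ltnn in ltj.
  by move=> /ulam12_ltn; lia.
rewrite -[leqRHS]reps1 /ulam_reps -!size_filter.
(* Distinct [u] give distinct pairs [(u, n - u)], all among the representations of [n]. *)
rewrite -(size_map (fun u => (u, n - u)%N)).
apply: uniq_leq_size => [|_ /mapP[u + ->]].
  by rewrite map_inj_uniq ?filter_uniq // => x y [].
rewrite mem_filter => /andP[nuU su]; have ltu := sn _ su.
have u0 : (0 < u)%N by rewrite U12_gt0 ?sU.
rewrite mem_filter /= ltu subnKC ?eqxx ?allpairs_f ?initP ?(sU u) //; lia.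
Qed.

(** The first seven Ulam numbers; the largest, 11, is the greatest distance inside a window of
    length 12. *)
Definition ulam_gaps : seq nat := [:: 1; 2; 3; 4; 6; 8; 11]%N.

Lemma ulam_gaps_in_U12 : {in ulam_gaps, forall u, u \in U12}.
Proof.
have next m n (s := ulam_initial m) :
    ulam_candidate s n && ~~ has (ulam_candidate s) (iota 0 n) ->
    ulam_initial m.+1 = n :: s.
  by move=> /andP[? ?]; rewrite ulam_initialS (ulam_next_eq _ n).
have i0 : ulam_initial 0 = [:: 2; 1]%N by [].
have i1 : ulam_initial 1 = [:: 3; 2; 1]%N by rewrite (next _ 3%N) i0.
have i2 : ulam_initial 2 = [:: 4; 3; 2; 1]%N by rewrite (next _ 4%N) i1.
have i3 : ulam_initial 3 = [:: 6; 4; 3; 2; 1]%N by rewrite (next _ 6%N) i2.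
have i4 : ulam_initial 4 = [:: 8; 6; 4; 3; 2; 1]%N by rewrite (next _ 8%N) i3.
have i5 : ulam_initial 5 = [:: 11; 8; 6; 4; 3; 2; 1]%N.
  by rewrite (next _ 11%N) i4.
by move=> u ugap; apply: (@ulam_initial_sub_U12 5); rewrite i5 -mem_rev.
Qed.

Fixpoint bitseq_all (n : nat) (P : pred bitseq) : bool :=
  if n is m.+1 then
    bitseq_all m (fun w => P (true :: w)) && bitseq_all m (fun w => P (false :: w))
  else P [::].

Lemma bitseq_allP (n : nat) (P : pred bitseq) (w : bitseq) :
  bitseq_all n P -> size w = n -> P w.
Proof.
elim: n P w => [|n IHn] P [|[] w] //= /andP[Pt Pf] [szw].
  exact: (IHn (fun w => P (true :: w))).
exact: (IHn (fun w => P (false :: w))).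
Qed.

(** The guard [u <= i] keeps truncated subtraction from reading position 0 in place of one before
    the window. *)
Definition gap_sparse (w : bitseq) : bool :=
  all (fun i => nth false w i ==>
         (count (fun u => (u <= i) && nth false w (i - u)) ulam_gaps <= 1))%N
      (iota 0 (size w)).

Lemma gap_sparse_count (w : bitseq) :
  size w = 12%N -> gap_sparse w -> (count id w <= 4)%N.
Proof.
pose P (v : bitseq) := gap_sparse v ==> (count id v <= 4)%N.
move=> szw sw; apply: (implyP (_ : P w)) => //.
(* The finite check, over all [2^12] words. *)
by apply: bitseq_allP szw; vm_compute.
Qed.

Lemma U12_window (a : nat) :
  (22 < a)%N -> (count (mem U12) (iota a 12) <= 4)%N.
Proof.
move=> a22; pose w := [seq x \in U12 | x <- iota a 12].
have szw : size w = 12%N by rewrite size_map size_iota.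
have nthw i : (i < 12)%N -> nth false w i = ((a + i)%N \in U12).
  by move=> i12; rewrite (nth_map 0%N) ?size_iota // nth_iota.
rewrite -[count _ _](count_map (mem U12) id).
apply: gap_sparse_count => //; apply/allP => i; rewrite szw mem_iota => /andP[_ i12].
apply/implyP; rewrite nthw // => aiU.
apply: leq_trans (U12_reps _ _ _ aiU _ ulam_gaps_in_U12 _) => //; last 2 first.
- lia.
(* As [u <= 11], the bound [22 < a] gives [2 * u < a + i]. *)
- by move=> u; rewrite !inE; lia.
apply: sub_count => u /= /andP[ui]; rewrite nthw ?addnBA //.
exact: leq_ltn_trans (leq_subr _ _) i12.
Qed.

Lemma U12_count_iota (q : nat) :
  (count (mem U12) (iota 23 (q * 12)) <= q * 4)%N.
Proof.
by elim: q => // q IHq; rewrite 2!mulSnr iotaD count_cat leq_add ?U12_window.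
Qed.

Lemma U12_count_le (k : nat) : (3 * U12_count k <= k + 78)%N.
Proof.
have count_le : (U12_count k <= count (mem U12) (iota 1 k))%N.
  rewrite -size_filter; apply: uniq_leq_size => // x.
  rewrite in_fset_set; last first.
    by apply: (sub_finite_set _ (finite_II k.+1)) => y [_ /=]; lia.
  by move=> /set_mem[/mem_set xU /= xk]; rewrite mem_filter /= xU mem_iota; lia.
(* The numbers 1 to 22 and [q] windows from 23 on cover [[1, k]]. As [12 * q <= k + 12], thrice the
   count is at most [66 + 12 * q <= k + 78]. *)
pose q := (k %/ 12).+1.
have k_lt : (k < q * 12)%N by rewrite -ltn_divLR.
have kq : (q * 12 <= k + 12)%N by have := leq_trunc_div k 12; rewrite /q; lia.
have : (count (mem U12) (iota 1 k) <= 22 + q * 4)%N.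
  apply: (@leq_trans (count (mem U12) (iota 1 (22 + q * 12)))).
    have -> : (22 + q * 12 = k + (22 + q * 12 - k))%N by lia.
    by rewrite iotaD count_cat leq_addr.
  rewrite iotaD count_cat leq_add ?U12_count_iota //.
  by rewrite (leq_trans (count_size _ _)) ?size_iota.
lia.
Qed.

(** The limsup is an infimum of suprema over neighbourhoods of infinity, and the tail from [N] on is
    one of these. *)
Lemma limn_esup_le_near (R : realType) (u : nat -> \bar R) (l : \bar R) (N : nat) :
  (forall k, (N <= k)%N -> (u k <= l)%E) -> (limn_esup u <= l)%E.
Proof.
move=> ul; rewrite /limn_esup limf_esupE.
apply: (@le_trans _ _ (ereal_sup (u @` [set k | (N <= k)%N])%classic)).
  by apply: ereal_inf_lbound; exists [set k | (N <= k)%N]%classic => //; exists N.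
by apply: ge_ereal_sup => _ [k Nk <-]; exact: ul.
Qed.

Theorem theorem4p9 (R : realType) :
  (limn_esup (fun k : nat => ((U12_count k)%:R / k%:R : R)%:E)
     <= (6 / 17 : R)%:E)%E.
Proof.
(* [(k + 78) / 3 <= 6 * k / 17] holds exactly when [k >= 17 * 78 = 1326]. *)
apply: (@limn_esup_le_near _ _ _ 1326) => k k_ge; rewrite lee_fin.
have k0 : 0 < k%:R :> R by rewrite ltr0n; lia.
have := U12_count_le k; rewrite -(ler_nat R) natrM natrD => cle.
rewrite ler_pdivrMr //; move: k_ge; rewrite -(ler_nat R); lra.
Qed.
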